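(* Let $V_1,V_2\in C(\mathbb{T}^n)$ and $H_i(\xi,p)=|p|^2-V_i(\xi)$ for $i=1,2$. Assume that $V_i\ge0$ in $\mathbb{T}^n$ and put $U_i:=\{V_i=0\}\subset\mathbb{T}^n$ for $i=1,2$. Assume further that $U_1\cap U_2\neq\emptyset$ and that there exist open sets $W_1,W_2$ in $\mathbb{T}^n$ and a vector $q\in\mathbb{R}^n$ such that $\Pi(q+W_2)\Subset(0,1)^n$ and $$U_1\cup U_2\subset W_1\subset W_2,\qquad \operatorname{dist}(W_1,\partial W_2)>0,\qquad \operatorname{dist}(U_1\cup U_2,\partial W_1)>0.$$ Then there exists $\gamma>0$ such that $\overline{H}(P)=0$ for all $P\in\mathbb{R}^n$ with $|P|\le\gamma$.
   Context: $\mathbb{T}^n=\mathbb{R}^n/\mathbb{Z}^n$ is identified with $[0,1]^n$ (opposite faces glued), $\Pi:\mathbb{R}^n\to\mathbb{T}^n$ is the canonical projection, and subsets of, and functions on, $\mathbb{T}^n$ are identified with their $\mathbb{Z}^n$-periodic extensions to $\mathbb{R}^n$. $A\Subset B$ means that $A$ is compactly contained in $B$. Effective Hamiltonian: for each $P\in\mathbb{R}^n$ it is known that there is a unique constant $\overline{H}(P)$ such that the cell problem $$H_1(\xi,P+Dv_1(\xi))+v_1(\xi)-v_2(\xi)=\overline{H}(P),\qquad H_2(\xi,P+Dv_2(\xi))+v_2(\xi)-v_1(\xi)=\overline{H}(P)\quad\text{in }\mathbb{T}^n$$ admits a continuous viscosity solution $(v_1,v_2)\in C(\mathbb{T}^n)^2$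 (viscosity inequalities are imposed on each component with the other component inserted as a given function). *)

(* Defs.v *)
From HB Require Import structures.
From mathcomp Require Import all_boot all_order all_algebra.
From mathcomp Require Import all_classical all_reals all_analysis.

Set Implicit Arguments.
Unset Strict Implicit.
Unset Printing Implicit Defensive.

Import Order.TTheory GRing.Theory Num.Theory.
Import numFieldNormedType.Exports.

Local Open Scope classical_set_scope.
Local Open Scope ring_scope.

(* Subsets of, and functions on, the torus R^n / Z^n are represented by their
   Z^n-periodic extensions to R^n = 'rV[R]_n. Periodic open sets and periodic
   continuous functions are exactly the lifts of open sets and continuous
   functions of the torus, and closure, interior and boundary commute with
   lifting. *)

(* The norm that the library puts on 'rV[R]_n is the sup norm; it induces the
   topology, but lengths below are Euclidean. *)
Definition enorm (R : realType) (n : nat) (p : 'rV[R]_n) : R :=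
  Num.sqrt (\sum_(i < n) p 0 i ^+ 2).

Definition int_vec (R : realType) (n : nat) (k : 'rV[int]_n) : 'rV[R]_n :=
  map_mx intr k.

Definition periodic_fun (R : realType) (n : nat) (f : 'rV[R]_n -> R) : Prop :=
  forall (x : 'rV[R]_n) (k : 'rV[int]_n), f (x + int_vec R k) = f x.

Definition periodic_set (R : realType) (n : nat) (A : set 'rV[R]_n) : Prop :=
  forall (x : 'rV[R]_n) (k : 'rV[int]_n), A (x + int_vec R k) <-> A x.

Definition zero_set (R : realType) (n : nat) (V : 'rV[R]_n -> R) :
  set 'rV[R]_n := [set x | V x = 0].

Definition boundary (T : topologicalType) (A : set T) : set T :=
  closure A `\` interior A.

(* For periodic A and B this is also the distance between the corresponding
   subsets of the torus, the torus distance of two points being the minimum of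
   the distances between their lifts. It is +oo when A or B is empty. *)
Definition set_dist (R : realType) (n : nat) (A B : set 'rV[R]_n) : \bar R :=
  ereal_inf [set z | exists x y : 'rV[R]_n,
                       [/\ A x, B y & z = (enorm (x - y))%:E]].

Definition translate (R : realType) (n : nat) (q : 'rV[R]_n)
  (A : set 'rV[R]_n) : set 'rV[R]_n := [set q + x | x in A].

(* The image of A under the projection R^n -> T^n, seen as a subset of the
   closed cube [0,1]^n whose opposite faces are glued: a point of a face is
   listed together with all the points it is glued to. *)
Definition torus_proj (R : realType) (n : nat) (A : set 'rV[R]_n) :
  set 'rV[R]_n :=
  [set x : 'rV[R]_n | (forall i : 'I_n, 0 <= x 0 i <= 1) /\
           exists k : 'rV[int]_n, A (x + int_vec R k)].

Definition open_cube (R : realType) (n : nat) : set 'rV[R]_n :=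
  [set x : 'rV[R]_n | forall i : 'I_n, 0 < x 0 i < 1].

Definition compactly_contained (T : topologicalType) (A B : set T) : Prop :=
  compact (closure A) /\ closure A `<=` B.

Definition grad (R : realType) (n : nat) (phi : 'rV[R]_n -> R)
  (x : 'rV[R]_n) : 'rV[R]_n :=
  \row_(i < n) 'D_(delta_mx 0 i) phi x.

Definition C1 (R : realType) (n : nat) (phi : 'rV[R]_n -> R) : Prop :=
  (forall x : 'rV[R]_n, differentiable phi x) /\ continuous (grad phi).

Definition local_max_at (T : topologicalType) (R : realType) (f : T -> R)
  (x : T) : Prop := \forall y \near x, f y <= f x.

Definition local_min_at (T : topologicalType) (R : realType) (f : T -> R)
  (x : T) : Prop := \forall y \near x, f x <= f y.

(* Viscosity sub- and supersolutions, among continuous functions, of the scalar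
   equation F x (v x) (Dv x) = 0 in R^n. *)
Definition viscosity_subsolution (R : realType) (n : nat)
  (F : 'rV[R]_n -> R -> 'rV[R]_n -> R) (v : 'rV[R]_n -> R) : Prop :=
  forall (phi : 'rV[R]_n -> R) (x : 'rV[R]_n),
    C1 phi -> local_max_at (fun y => v y - phi y) x ->
    F x (v x) (grad phi x) <= 0.

Definition viscosity_supersolution (R : realType) (n : nat)
  (F : 'rV[R]_n -> R -> 'rV[R]_n -> R) (v : 'rV[R]_n -> R) : Prop :=
  forall (phi : 'rV[R]_n -> R) (x : 'rV[R]_n),
    C1 phi -> local_min_at (fun y => v y - phi y) x ->
    0 <= F x (v x) (grad phi x).

Definition viscosity_solution (R : realType) (n : nat)
  (F : 'rV[R]_n -> R -> 'rV[R]_n -> R) (v : 'rV[R]_n -> R) : Prop :=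
  viscosity_subsolution F v /\ viscosity_supersolution F v.

(* One line of the cell problem: the unknown is v, and the other component w is
   a given function. *)
Definition cell_equation (R : realType) (n : nat)
  (H : 'rV[R]_n -> 'rV[R]_n -> R) (P : 'rV[R]_n) (c : R) (w : 'rV[R]_n -> R) :
  'rV[R]_n -> R -> 'rV[R]_n -> R :=
  fun x r p => H x (P + p) + r - w x - c.

Definition cell_solution (R : realType) (n : nat)
  (H1 H2 : 'rV[R]_n -> 'rV[R]_n -> R) (P : 'rV[R]_n) (c : R)
  (v1 v2 : 'rV[R]_n -> R) : Prop :=
  [/\ continuous v1 /\ periodic_fun v1,
      continuous v2 /\ periodic_fun v2,
      viscosity_solution (cell_equation H1 P c v2) v1
    & viscosity_solution (cell_equation H2 P c v1) v2].

Definition cell_solvable (R : realType) (n : nat)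
  (H1 H2 : 'rV[R]_n -> 'rV[R]_n -> R) (P : 'rV[R]_n) (c : R) : Prop :=
  exists v1 v2 : 'rV[R]_n -> R, cell_solution H1 H2 P c v1 v2.

Definition is_effective_hamiltonian (R : realType) (n : nat)
  (H1 H2 : 'rV[R]_n -> 'rV[R]_n -> R) (Hbar : 'rV[R]_n -> R) : Prop :=
  forall P : 'rV[R]_n,
    cell_solvable H1 H2 P (Hbar P) /\
    forall c : R, cell_solvable H1 H2 P c -> c = Hbar P.

Definition quadratic_hamiltonian (R : realType) (n : nat)
  (V : 'rV[R]_n -> R) : 'rV[R]_n -> 'rV[R]_n -> R :=
  fun x p => enorm p ^+ 2 - V x.

(* Main.v *)
(* Lower bound: penalising with |y - x|^2 / r^2 shows that a subsolution v_i of
   the cell problem satisfies v_i - v_j - V_i <= Hbar(P) at every point. Adding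
   the two inequalities at a common zero of V_1 and V_2 gives 0 <= Hbar(P).

   Upper bound: there is a C^1 periodic w with |P + Dw|^2 <= V_i for both i.
   Since the zeros of V_1 and V_2 project into a compact part of an open unit
   cube, each coordinate can be flattened separately: w(x) + P.x is the sum of
   P_i K(x_i + q_i), where K is a C^1 staircase with K(t + 1) = K(t) + 1 that is
   constant away from the integers. Hence P + Dw vanishes on W_2, and it is
   small with P on the complement, where the V_i are bounded below. At the
   minimum of v_i - w over the points and over i the coupling term is
   nonpositive and w is a test function, which gives Hbar(P) <= 0. *)

Require Import Defs.
From HB Require Import structures.
From mathcomp Require Import all_boot all_order all_algebra.
From mathcomp Require Import all_classical all_reals all_analysis.
From mathcomp Require Import ring lra.

Import Order.TTheory GRing.Theory Num.Theory.
Import numFieldNormedType.Exports.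

Local Open Scope classical_set_scope.
Local Open Scope ring_scope.

(** * Separable functions and their gradients *)

Lemma continuous_to_rV (R : realType) (T : topologicalType) (n : nat)
    (f : T -> 'rV[R]_n) (x : T) :
  (forall i, {for x, continuous (fun y => f y 0 i)}) -> {for x, continuous f}.
Proof.
move=> cf A /nbhs_ballP[e /= e0 eA].
have : \forall y \near x, forall i, ball (f x 0 i) e (f y 0 i).
  apply: filter_forall => i.
  by apply: (cf i); apply: nbhsx_ballx.
rewrite near_simpl; apply: filterS => y Hy; apply: eA.
split=> // i j; rewrite (ord1 i); exact: Hy.
Qed.

(** Both the quadratic penalty of the lower bound and the corrector of the upper bound have this
    form, which reduces their gradients to one-variable derivatives. *)
Definition separable (R : realType) (n : nat) (f : 'I_n -> R -> R) :
  'rV[R]_n -> R := fun x => \sum_(i < n) f i (x 0 i).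

Section Separable.
Variables (R : realType) (n : nat) (f df : 'I_n -> R -> R).
Hypothesis fdf : forall i (t : R), is_derive t 1 (f i) (df i t).

Let diff_term (i : 'I_n) (x : 'rV[R]_n) :
  differentiable (fun y : 'rV[R]_n => f i (y 0 i)) x.
Proof.
apply: (@differentiable_comp _ _ _ _ (fun y : 'rV[R]_n => y 0 i) (f i)).
  exact: differentiable_coord.
by apply/derivable1_diffP; have [] := fdf i (x 0 i).
Qed.

Let separableE :
  separable R n f = \sum_(i < n) (fun y : 'rV[R]_n => f i (y 0 i)).
Proof. by apply/funext => x; rewrite fct_sumE. Qed.

Lemma differentiable_separable (x : 'rV[R]_n) :
  differentiable (separable R n f) x.
Proof. rewrite separableE; apply: differentiable_sum => i; exact: diff_term. Qed.

Lemma derive_coord (i : 'I_n) (v x : 'rV[R]_n) :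
  'D_v (fun y : 'rV[R]_n => f i (y 0 i)) x = v 0 i * df i (x 0 i).
Proof.
have dfi : differentiable (f i) (x 0 i).
  by apply/derivable1_diffP; have [] := fdf i (x 0 i).
have -> : 'D_v (fun y : 'rV[R]_n => f i (y 0 i)) x = 'D_(v 0 i) (f i) (x 0 i).
  by rewrite /derive /=; under eq_fun do rewrite !mxE.
rewrite deriveE // diff1E // derive1E; have [_ ->] := fdf i (x 0 i).
by [].
Qed.

Lemma grad_separable (x : 'rV[R]_n) :
  grad (separable R n f) x = \row_i df i (x 0 i).
Proof.
apply/rowP => j; rewrite !mxE separableE derive_sum; last first.
  by move=> i; apply/diff_derivable/diff_term.
rewrite (bigD1 j) //= big1 ?addr0 => [|i /negPf ij]; rewrite derive_coord mxE.
  by rewrite !eqxx mul1r.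
by rewrite ij andbF mul0r.
Qed.

Hypothesis cdf : forall i, continuous (df i).

Lemma C1_separable : C1 (separable R n f).
Proof.
split; first exact: differentiable_separable.
move=> x; apply: continuous_to_rV => i.
have -> : (fun y => grad (separable R n f) y 0 i) = df i \o (fun y => y 0 i).
  by apply/funext => y; rewrite grad_separable mxE.
by apply: continuous_comp; [exact: coord_continuous|exact: cdf].
Qed.

End Separable.

(** * A $C^1$ step on the line and its derivative *)

Lemma continuous_max0 (R : realType) : continuous (fun u : R => Num.max u 0).
Proof.
have -> : (fun u : R => Num.max u 0) = (fun u => (u + `|u|) / 2).
  by apply/funext => u; rewrite maxr_absE addr0 subr0.
move=> u; apply: cvgM; last exact: cvg_cst.
by apply: cvgD; [exact: cvg_id|exact: norm_continuous].
Qed.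

Definition pos2 (R : realType) (u : R) : R := Num.max u 0 ^+ 2.

Lemma is_derive_pos2 (R : realType) (u : R) :
  is_derive u 1 (pos2 R) (2 * Num.max u 0).
Proof.
have [u0|u0|->] := ltgtP u 0.
- apply: (@near_eq_is_derive _ _ _ (cst 0)); last first.
    by rewrite mulr0; exact: is_derive_cst.
  near=> t; rewrite /pos2 max_r ?expr0n //=.
  by apply/ltW; near: t; exact: lt_nbhsl.
- apply: (@near_eq_is_derive R R R (@GRing.exp R ^~ 2%N) _ u 1); last first.
    by apply: is_derive_eq; rewrite /GRing.scale /= ; ring.
  near=> t; rewrite /pos2 max_l //=.
  by apply/ltW; near: t; exact: lt_nbhsr.
(* At the kink the difference quotient of [pos2] is $\max(h,0)$ itself, which tends to 0. *)
- have lim0 : h^-1 *: ((pos2 R \o shift 0) (h *: 1) - pos2 R 0) @[h --> 0^'] --> (0 : R).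
    have : (fun h : R => Num.max h 0) @ (0 : R)^' --> (0 : R).
      apply: cvg_within_filter.
      have /(_ (0 : R)) := @continuous_max0 R.
      by rewrite /continuous_at maxxx.
    apply: cvg_trans; apply: near_eq_cvg; near=> h.
    have h0 : h != 0 by near: h; exact: nbhs_dnbhs_neq.
    rewrite /= /pos2 addr0 maxxx expr0n subr0 /GRing.scale /= mulr1.
    by have [] := ltgtP h 0 => hh; rewrite ?expr0n ?mulr0// expr2 mulrA mulVf ?mul1r.
  by rewrite mulr0; split; [apply/cvg_ex; exists 0|exact: cvg_lim].
Unshelve. all: by end_near. Qed.

Lemma is_derive_translate (R : realType) (f : R -> R) (t c d : R) :
  is_derive (t + c) 1 f d -> is_derive t 1 (fun s => f (s + c)) d.
Proof.
have E : (fun h : R => h^-1 *: (((fun s => f (s + c)) \o shift t) (h *: 1) - f (t + c)))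
       = (fun h : R => h^-1 *: ((f \o shift (t + c)) (h *: 1) - f (t + c))).
  by apply/funext => h /=; rewrite addrA.
by move=> [df <-]; split; rewrite /derivable /derive /= ?E.
Qed.

(* The third antiderivative of (delta_{-a} - 2 delta_0 + delta_a) / a^2: a C^1
   step from 0 to 1. *)
Definition ramp (R : realType) (a u : R) : R :=
  (pos2 R (u + a) - 2 * pos2 R u + pos2 R (u - a)) / (2 * a ^+ 2).

Definition tent (R : realType) (a u : R) : R :=
  (Num.max (u + a) 0 - 2 * Num.max u 0 + Num.max (u - a) 0) / a ^+ 2.

Section Ramp.
Variables (R : realType) (a : R).
Hypothesis a0 : 0 < a.

Lemma ramp_eq0 (u : R) : u <= - a -> ramp R a u = 0.
Proof.
move=> ua; have := a0; rewrite /ramp /pos2 => a_gt0.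
by rewrite !max_r; lra.
Qed.

Lemma ramp_eq1 (u : R) : a <= u -> ramp R a u = 1.
Proof.
move=> ua; have := a0; rewrite /ramp /pos2 => a_gt0.
rewrite !max_l; try lra.
by field; rewrite gt_eqF.
Qed.

Lemma is_derive_ramp (u : R) : is_derive u 1 (ramp R a) (tent R a u).
Proof.
have Hp := is_derive_translate _ _ _ _ _ (is_derive_pos2 R (u + a)).
have Hm := is_derive_translate _ _ _ _ _ (is_derive_pos2 R (u - a)).
have H0 := is_derive_pos2 R u.
have -> : ramp R a = (2 * a ^+ 2)^-1 \*: ((fun s => pos2 R (s + a)) -
    2 \*: pos2 R + (fun s => pos2 R (s - a))).
  by apply/funext => s; rewrite /ramp mulrC.
apply: is_derive_eq.
rewrite /GRing.scale /= /tent; field.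
by rewrite gt_eqF.
Qed.

Lemma continuous_tent : continuous (tent R a).
Proof.
have cm c : continuous (fun s : R => Num.max (s + c) 0).
  move=> s; apply: (@continuous_comp _ _ _ (fun t => t + c) (fun t => Num.max t 0)).
    by apply: cvgD; [exact: cvg_id|exact: cvg_cst].
  exact: continuous_max0.
move=> u; apply: cvgM; last exact: cvg_cst.
apply: cvgD; last exact: cm.
apply: cvgB; first exact: cm.
by apply: cvgM; [exact: cvg_cst|exact: continuous_max0].
Qed.

Lemma tent_ge0 (u : R) : 0 <= tent R a u.
Proof.
rewrite /tent divr_ge0 ?sqr_ge0//.
by rewrite /Num.max; do ! case: ifPn; rewrite -?leNgt; have := a0; lra.
Qed.

Lemma tent_le (u : R) : tent R a u <= a^-1.
Proof.
rewrite /tent ler_pdivrMr ?exprn_gt0// expr2 mulKf ?gt_eqF//.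
by rewrite /Num.max; do ! case: ifPn; rewrite -?leNgt; have := a0; lra.
Qed.

Lemma tent_eq0 (u : R) : a <= `|u| -> tent R a u = 0.
Proof.
rewrite ler_normr => /orP H; rewrite /tent.
suff -> : Num.max (u + a) 0 - 2 * Num.max u 0 + Num.max (u - a) 0 = 0.
  by rewrite mul0r.
by case: H => H; rewrite /Num.max; do ! case: ifPn; rewrite -?leNgt; have := a0; lra.
Qed.

(** * The staircase *)

Definition nint (t : R) : int := Num.floor (t + 2^-1).

Lemma nint_dist (t : R) : `|t - (nint t)%:~R| <= 2^-1.
Proof.
rewrite ler_norml; have := floor_le (t + 2^-1); have := floorD1_gt (t + 2^-1).
by rewrite /nint intrD; lra.
Qed.

Lemma nintD (t : R) (k : int) : nint (t + k%:~R) = nint t + k.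
Proof.
by rewrite /nint addrAC floorDrz ?intrKfloor// intr_int.
Qed.

(** One ramp is centred at each integer. If $a<1/2$, the jump of [nint] at a half-integer is
    harmless: the ramp has reached 1 on the left and is still 0 on the right. *)
Definition stair (t : R) : R := (nint t)%:~R + ramp R a (t - (nint t)%:~R).

Lemma stairD (t : R) (k : int) : stair (t + k%:~R) = stair t + k%:~R.
Proof.
rewrite /stair nintD intrD [in LHS](_ : t + _ - _ = t - (nint t)%:~R); lra.
Qed.

(* On an interval overlapping the neighbouring cells the nearest integer may be
   replaced by a fixed one, so the staircase is as regular as the ramp. *)
Lemma stair_local (t : R) (m : int) :
  a < 2^-1 -> `|t - m%:~R| < 1 - a ->
  stair t = m%:~R + ramp R a (t - m%:~R).
Proof.
move=> a2; rewrite /stair; have := nint_dist t; set k := nint t.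
rewrite ler_norml ltr_norml => /andP[k1 k2] /andP[m1 m2].
have [km|km|->//] := ltgtP k m.
(* Since $|k-m|<3/2-a$, the two integers are adjacent. Then [t] is at distance at least [a] from
   both, so one ramp equals 1, the other 0, and the two formulas agree. *)
- have : (k + 1)%:~R <= m%:~R :> R by rewrite ler_int lezD1.
  rewrite intrD => km1.
  have -> : m%:~R = k%:~R + 1 :> R.
    apply/eqP; rewrite eq_le; apply/andP; split=> //.
    rewrite -[1]/(1%:~R) -intrD ler_int -ltzD1 -(ltr_int R) !intrD.
    have := a0; lra.
  by rewrite ramp_eq1 ?ramp_eq0; lra.
- have : (m + 1)%:~R <= k%:~R :> R by rewrite ler_int lezD1.
  rewrite intrD => km1.
  have -> : k%:~R = m%:~R + 1 :> R.
    apply/eqP; rewrite eq_le; apply/andP; split=> //.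
    rewrite -[1]/(1%:~R) -intrD ler_int -ltzD1 -(ltr_int R) !intrD.
    have := a0; lra.
  by rewrite ramp_eq0 ?ramp_eq1; lra.
Qed.

End Ramp.

(** * The pointwise inequality for subsolutions *)

Lemma continuous_sub (T : topologicalType) (R : realType) (f g : T -> R) :
  continuous f -> continuous g -> continuous (fun x => f x - g x).
Proof. by move=> cf cg x; apply: cvgB; [exact: cf|exact: cg]. Qed.

Lemma near_open_box (R : realType) (n : nat) (x : 'rV[R]_n) (l u : 'I_n -> R) :
  (forall i, l i < x 0 i < u i) ->
  \forall y \near x, forall i, l i < (y : 'rV[R]_n) 0 i < u i.
Proof.
move=> lxu.
have lyu i : nbhs x [set y : 'rV[R]_n | l i < y 0 i < u i].
  apply: (@coord_continuous R 1 n 0 i x [set t | l i < t < u i]).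
  apply: open_nbhs_nbhs; split; last exact: lxu.
  by rewrite -set_itvoo; exact: interval_open.
exact: (@filter_forall _ _ (fun i => [set y : 'rV[R]_n | l i < y 0 i < u i]) _
  (nbhs_filter x) lyu).
Qed.

Lemma compact_box (R : realType) (n : nat) (l u : 'I_n -> R) :
  compact [set x : 'rV[R]_n | forall i, l i <= x 0 i <= u i].
Proof.
have := @rV_compact R n (fun i => `[l i, u i]%classic) (fun i => @segment_compact _ _ _).
by congr compact; apply/seteqP; split=> x /= Hx i; move: (Hx i); rewrite /= in_itv.
Qed.

(** Wherever a test function touches [v] from above, dropping the nonnegative squared gradient gives
    the bound. If it failed at one point it would fail on a neighbourhood, and a steep paraboloid
    forces a touching point there. *)
Lemma subsolution_le (R : realType) (n : nat) (V v w : 'rV[R]_n -> R)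
    (P : 'rV[R]_n) (c : R) :
  continuous V -> continuous v -> continuous w ->
  viscosity_subsolution (cell_equation (quadratic_hamiltonian V) P c w) v ->
  forall x, v x - w x - V x <= c.
Proof.
move=> cV cv cw sub x0; rewrite leNgt; apply/negP => cx0.
have cg : continuous (fun x => v x - w x - V x).
  by apply: continuous_sub => //; exact: continuous_sub.
have : \forall x \near x0, c < v x - w x - V x /\ v x < v x0 + 1.
  near=> x; split; near: x.
    exact: (cvgr_gt _ (cg x0)).
  by apply: (cvgr_lt _ (cv x0)); rewrite ltrDl.
move=> /nbhs_ballP[e /= e0 near_x0].
(* Halving the radius keeps the closed box inside the open sup-norm ball. *)
pose r := e / 2; have r0 : 0 < r by rewrite divr_gt0.
pose box := [set x : 'rV[R]_n | forall i, x0 0 i - r <= x 0 i <= x0 0 i + r].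
have box_near x : box x -> c < v x - w x - V x /\ v x < v x0 + 1.
  move=> bx; apply: near_x0; split=> // i j; rewrite (ord1 i).
  have := bx j; rewrite /ball /= ltr_norml /r; have := e0; lra.
pose f := fun (i : 'I_n) (t : R) => (t - x0 0 i) ^+ 2 / r ^+ 2.
pose df := fun (i : 'I_n) (t : R) => 2 * (t - x0 0 i) / r ^+ 2.
have fdf i (t : R) : is_derive t 1 (f i) (df i t).
  have -> : f i = (r ^+ 2)^-1 \*: ((id : R -> R) - cst (x0 0 i)) ^+ 2.
    by apply/funext => s; rewrite /f mulrC.
  apply: is_derive_eq; rewrite /GRing.scale /= /df !fctE; ring.
have cdf i : continuous (df i).
  move=> t; apply: cvgM; last exact: cvg_cst.
  by apply: cvgM; [exact: cvg_cst|apply: cvgB; [exact: cvg_id|exact: cvg_cst]].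
pose phi := separable R n f.
have C1phi : C1 phi by exact: (C1_separable _ _ _ df).
have f_ge0 i t : 0 <= f i t by rewrite /f divr_ge0 ?sqr_ge0.
have phix0 : phi x0 = 0.
  by rewrite /phi /separable big1 // => i _; rewrite /f subrr expr0n mul0r.
have box0 : box x0 by move=> i; have := r0; lra.
have cphi : continuous phi.
  by move=> x; apply: differentiable_continuous; have [] := C1phi.
have [x xbox xmax] : exists2 x, x \in box &
    forall y, y \in box -> v y - phi y <= v x - phi x.
  apply: EVT_max_rV; [by exists x0|exact: compact_box|].
  exact/continuous_subspaceT/continuous_sub.
move: xbox; rewrite inE => xbox; have [cx vx] := box_near _ xbox.
(* The maximiser is interior: on a face the penalty is at least 1, whereas [v] exceeds [v x0] by
   less than 1 on the box, so [x0] would do better. *)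
have xint i : x0 0 i - r < x 0 i < x0 0 i + r.
  apply: contraT => xi.
  have fi : f i (x 0 i) = 1.
    have xr : (x 0 i - x0 0 i - r) * (x 0 i - x0 0 i + r) = 0.
      apply/eqP; rewrite mulf_eq0; apply/orP.
      have /andP[li ui] := xbox i; move: xi; rewrite negb_and -!leNgt.
      by move=> /orP[] xi; [right|left]; apply/eqP; lra.
    have -> : f i (x 0 i) = (x 0 i - x0 0 i) ^+ 2 / r ^+ 2 by [].
    have -> : (x 0 i - x0 0 i) ^+ 2 = r ^+ 2 by move: xr; lra.
    by rewrite divff// expf_neq0// gt_eqF.
  have : 1 <= phi x.
    rewrite /phi /separable (bigD1 i) //= fi lerDl.
    by apply: sumr_ge0.
  have := xmax x0; rewrite inE phix0 => /(_ box0); lra.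
have locx : local_max_at (fun y => v y - phi y) x.
  have : \forall y \near x, forall i, x0 0 i - r < (y : 'rV[R]_n) 0 i < x0 0 i + r.
    exact: (near_open_box _ _ _ (fun i => x0 0 i - r) (fun i => x0 0 i + r)).
  move=> /(@filterS _ _ (nbhs_filter x)); apply=> y yint; apply: xmax; rewrite inE => i.
  by have /andP[/ltW-> /ltW->] := yint i.
rewrite /cell_equation /quadratic_hamiltonian in sub *.
have := sub _ x C1phi locx; have := sqr_ge0 (enorm (P + grad phi x)); lra.
Unshelve. all: by end_near. Qed.

(** * Minima of periodic functions and comparison with supersolutions *)

Lemma floor_coord (R : realType) (n : nat) (x : 'rV[R]_n) :
  exists k : 'rV[int]_n, forall i, 0 <= (x + int_vec R k) 0 i < 1.
Proof.
exists (\row_i - Num.floor (x 0 i)) => i; rewrite !mxE rmorphN /=.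
have := floor_le (x 0 i); have := floorD1_gt (x 0 i).
by rewrite intrD; lra.
Qed.

(** Integer translations bring every point of [A] into the compact unit cube without changing [f].
    Used with the whole space for the comparison, and with the complement of $W_2$ to bound the
    potentials below. *)
Lemma periodic_min (R : realType) (n : nat) (f : 'rV[R]_n -> R)
    (A : set 'rV[R]_n) :
  continuous f -> periodic_fun f -> closed A -> periodic_set A -> A !=set0 ->
  exists2 x, A x & forall y, A y -> f x <= f y.
Proof.
move=> cf pf clA pA [a Aa].
pose cube := [set x : 'rV[R]_n | forall i, 0 <= x 0 i <= 1].
have to_cube y : A y -> exists z, [/\ A z, cube z & f z = f y].
  move=> Ay; have [k Hk] := floor_coord _ _ y.
  exists (y + int_vec R k); split; [exact/pA| |exact: pf].
  by move=> i; have := Hk i; lra.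
have [x xA xmin] : exists2 x, x \in cube `&` A &
    forall y, y \in cube `&` A -> f x <= f y.
  apply: EVT_min_rV.
  - by have [z [Az cz _]] := to_cube _ Aa; exists z.
  - by apply: compact_closedI => //; exact: compact_box.
  - exact: continuous_subspaceT.
move: xA; rewrite inE => -[_ Ax]; exists x => // y /to_cube[z [Az cz <-]].
by apply: xmin; rewrite inE.
Qed.

(* At the minimum of [v1 - w] and [v2 - w] over the two components, the
   coupling term has the sign that lets the smaller component be compared
   with the scalar function [w]. *)
Lemma supersolution_le (R : realType) (n : nat) (V1 V2 v1 v2 w : 'rV[R]_n -> R)
    (P : 'rV[R]_n) (c : R) :
  continuous v1 -> periodic_fun v1 -> continuous v2 -> periodic_fun v2 ->
  periodic_fun w ->
  (forall x, exists phi, [/\ C1 phi, \forall y \near x, w y = phi y,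
     enorm (P + grad phi x) ^+ 2 <= V1 x & enorm (P + grad phi x) ^+ 2 <= V2 x]) ->
  viscosity_supersolution (cell_equation (quadratic_hamiltonian V1) P c v2) v1 ->
  viscosity_supersolution (cell_equation (quadratic_hamiltonian V2) P c v1) v2 ->
  c <= 0.
Proof.
(* The hypotheses are symmetric in the two indices, so the first component may be taken to attain
   the smaller minimum. *)
wlog : V1 V2 v1 v2 / exists x, forall y,
    v1 x - w x <= v1 y - w y /\ v1 x - w x <= v2 y - w y.
  move=> H cv1 pv1 cv2 pv2 pw hw s1 s2.
  (* Continuity of [w] is inherited from the smooth functions that coincide with it locally. *)
  have cw : continuous w.
    move=> x; have [phi [[dphi _] wphi _ _]] := hw x.
    rewrite /continuous_at (nbhs_singleton wphi).
    apply: cvg_trans (differentiable_continuous (dphi x)).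
    have phiw : \forall y \near x, phi y = w y.
      exact: (@filterS _ _ (nbhs_filter x) _ _ _ wphi).
    exact: near_eq_cvg phiw.
  have pmin v : continuous v -> periodic_fun v ->
      exists x, forall y, v x - w x <= v y - w y.
    move=> cv pv.
    have [x _ xmin] : exists2 x, [set: 'rV[R]_n] x &
        forall y, [set: 'rV[R]_n] y -> v x - w x <= v y - w y.
      apply: (periodic_min _ _ (fun y => v y - w y)) => //.
      - exact: continuous_sub.
      - by move=> x k; rewrite pv pw.
      - by exists 0.
    by exists x => y; exact: xmin.
  have [x1 x1min] := pmin _ cv1 pv1; have [x2 x2min] := pmin _ cv2 pv2.
  have [x12|/ltW x21] := lerP (v1 x1 - w x1) (v2 x2 - w x2).
    apply: (H V1 V2 v1 v2) => //; exists x1 => y; split=> //.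
    exact: le_trans x12 _.
  apply: (H V2 V1 v2 v1) => //.
    exists x2 => y; split=> //; exact: le_trans x21 _.
  by move=> x; have [phi []] := hw x; exists phi.
move=> [x xmin] _ _ _ _ _ hw s1 _.
have [phi [C1phi wphi P1 _]] := hw x.
have locx : local_min_at (fun y => v1 y - phi y) x.
  have wx := nbhs_singleton wphi.
  apply: (@filterS _ _ (nbhs_filter x) _ _ _ wphi) => y <-; rewrite -wx.
  by have [] := xmin y.
have := s1 _ x C1phi locx; rewrite /cell_equation /quadratic_hamiltonian.
have [_] := xmin x; move: P1; lra.
Qed.

(** * Uniform margins from compactness *)

Lemma sqr_enorm (R : realType) (n : nat) (p : 'rV[R]_n) :
  enorm p ^+ 2 = \sum_(i < n) p 0 i ^+ 2.
Proof. by rewrite sqr_sqrtr//; apply: sumr_ge0 => i _; exact: sqr_ge0. Qed.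

(** Each coordinate attains its extrema on [C], strictly between 0 and 1; every small enough [a]
    serves one coordinate, hence all of the finitely many. *)
Lemma cube_margin (R : realType) (n : nat) (C : set 'rV[R]_n) :
  compact C -> C `<=` @open_cube R n ->
  exists2 a : R, 0 < a < 2^-1 & forall x, C x -> forall i, a <= x 0 i <= 1 - a.
Proof.
move=> cC CO.
have near_a (i : 'I_n) : \forall a \near (0 : R)^'+, forall x, C x -> a <= x 0 i <= 1 - a.
  have [->|/set0P C0] := eqVneq C set0; first exact: nearW.
  have ci : {within C, continuous (fun x : 'rV[R]_n => x 0 i)}.
    exact/continuous_subspaceT/coord_continuous.
  have [y yC ymin] := EVT_min_rV C0 cC ci.
  have [z zC zmax] := EVT_max_rV C0 cC ci.
  move: yC zC; rewrite !inE => /CO/(_ i)/andP[y0 _] /CO/(_ i)/andP[_ z1].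
  have z0 : 0 < 1 - z 0 i by lra.
  near=> a => x Cx; have := ymin x; have := zmax x; rewrite inE => /(_ Cx) xz /(_ Cx) yx.
  have ay : a <= y 0 i by near: a; exact: nbhs_right_le.
  have az : a <= 1 - z 0 i by near: a; exact: nbhs_right_le.
  lra.
have near_all : \forall a \near (0 : R)^'+, forall (i : 'I_n) x, C x -> a <= x 0 i <= 1 - a.
  exact: filter_forall.
near (0 : R)^'+ => a; exists a.
  by apply/andP; split; near: a; [exact: nbhs_right_gt|apply: nbhs_right_lt].
by move=> x Cx i; move: x Cx; move: i; near: a.
Unshelve. all: by end_near. Qed.

(** Provides the half-width of the ramps: with this [a], the derivative of the staircase vanishes at
    every coordinate of a point of [W] shifted by [q]. *)
Lemma nint_margin (R : realType) (n : nat) (q : 'rV[R]_n) (W : set 'rV[R]_n) :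
  compactly_contained (torus_proj (translate q W)) (@open_cube R n) ->
  exists2 a : R, 0 < a < 2^-1 &
    forall x, W x -> forall i, a <= `|x 0 i + q 0 i - (nint R (x 0 i + q 0 i))%:~R|.
Proof.
move=> [cC CO]; have [a a01 aC] := cube_margin _ _ _ cC CO.
exists a => // x Wx i; have [k zk] := floor_coord _ _ (q + x).
have /aC/(_ i) : closure (torus_proj (translate q W)) (q + x + int_vec R k).
  apply: subset_closure; split=> [j|]; first by have := zk j; lra.
  exists (- k); exists x => //; apply/rowP => j; rewrite !mxE rmorphN /=; lra.
rewrite !mxE; set t := x 0 i + q 0 i; have -> : q 0 i + x 0 i = t by rewrite addrC.
(* With $N$ the integer [nint R t + k 0 i], the signed distance from [t] to its nearest integer is
   $(t+k_i)-N$, where $t+k_i\in[a,1-a]$: it is at least $a$ if $N\le0$ and at most $-a$ if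
   $N\ge1$. *)
have [kn|kn] := lerP (nint R t + k 0 i) 0.
  have : (nint R t + k 0 i)%:~R <= 0 :> R by rewrite lerz0.
  by rewrite intrD ler_normr; lra.
have : 1 <= (nint R t + k 0 i)%:~R :> R by rewrite ler1z -gtz0_ge1.
by rewrite intrD ler_normr; lra.
Qed.

Lemma periodic_pos_bound (R : realType) (n : nat) (V : 'rV[R]_n -> R)
    (A : set 'rV[R]_n) :
  continuous V -> periodic_fun V -> closed A -> periodic_set A ->
  (forall x, A x -> 0 < V x) -> exists2 d, 0 < d & forall x, A x -> d <= V x.
Proof.
move=> cV pV clA pA V0; have [A0|/set0P A0] := eqVneq A set0.
  by exists 1 => // x; rewrite A0.
have [x Ax xmin] := periodic_min _ _ _ _ cV pV clA pA A0.
by exists (V x); [exact: V0|].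
Qed.

(** * The corrector *)

Section Corrector.
Variables (R : realType) (n : nat) (a : R) (q P : 'rV[R]_n).
Hypotheses (a0 : 0 < a) (a2 : a < 2^-1).

(** Subtracting [t] removes the linear growth of the staircase, which gives periodicity; in $P+Dw$
    the resulting $-P$ cancels. *)
Definition corrector : 'rV[R]_n -> R :=
  separable R n (fun i t => P 0 i * (stair R a (t + q 0 i) - t)).

Lemma periodic_corrector : periodic_fun corrector.
Proof.
move=> x k; apply: eq_bigr => i _; rewrite !mxE (addrAC (x 0 i)) stairD.
by congr (_ * _); lra.
Qed.

Lemma corrector_local (x : 'rV[R]_n) : exists phi, [/\ C1 phi,
   \forall y \near x, corrector y = phi y &
   P + grad phi x =
     \row_i (P 0 i * tent R a (x 0 i + q 0 i - (nint R (x 0 i + q 0 i))%:~R))].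
Proof.
pose m i : R := (nint R (x 0 i + q 0 i))%:~R.
pose f i t := P 0 i * (m i + ramp R a (t + (q 0 i - m i)) - t).
pose df i t := P 0 i * (tent R a (t + (q 0 i - m i)) - 1).
have fdf i (t : R) : is_derive t 1 (f i) (df i t).
  have Hr := is_derive_translate _ _ _ _ _ (is_derive_ramp R a a0 (t + (q 0 i - m i))).
  have -> : f i = P 0 i \*: (cst (m i) + (fun s => ramp R a (s + (q 0 i - m i))) - id).
    by apply/funext => s.
  by apply: is_derive_eq; rewrite /GRing.scale /= /df add0r.
have cdf i : continuous (df i).
  move=> t; apply: cvgM; first exact: cvg_cst.
  apply: cvgB; last exact: cvg_cst.
  apply: (@continuous_comp _ _ _ (fun t => t + (q 0 i - m i)) (tent R a)).
    by apply: cvgD; [exact: cvg_id|exact: cvg_cst].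
  exact: continuous_tent.
exists (separable R n f); split; first exact: C1_separable cdf.
- have : \forall y \near x, forall i, m i - q 0 i - (1 - a) < (y : 'rV[R]_n) 0 i
      < m i - q 0 i + (1 - a).
    apply: (near_open_box _ _ _ (fun i => m i - q 0 i - (1 - a))
      (fun i => m i - q 0 i + (1 - a))) => i.
    by have := nint_dist R (x 0 i + q 0 i); rewrite -/(m i) ler_norml; have := a2; lra.
  move=> /(@filterS _ _ (nbhs_filter x)); apply=> y Hy.
  apply: eq_bigr => i _; rewrite (@stair_local R a a0 _ (nint R (x 0 i + q 0 i)))//.
    by rewrite /f addrA.
  by have := Hy i; rewrite -/(m i) ltr_norml; lra.
- rewrite (grad_separable _ _ _ _ fdf); apply/rowP => i.
  by rewrite !mxE /df addrA; ring.
Qed.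

End Corrector.

Theorem theorem4p11 (R : realType) (n : nat) (hn : (0 < n)%N)
  (V1 V2 : 'rV[R]_n -> R)
  (V1cont : continuous V1) (V1per : periodic_fun V1)
  (V2cont : continuous V2) (V2per : periodic_fun V2)
  (Hbar : 'rV[R]_n -> R)
  (HbarP : is_effective_hamiltonian
             (quadratic_hamiltonian V1) (quadratic_hamiltonian V2) Hbar)
  (V1ge0 : forall x : 'rV[R]_n, 0 <= V1 x)
  (V2ge0 : forall x : 'rV[R]_n, 0 <= V2 x)
  (U12 : zero_set V1 `&` zero_set V2 !=set0)
  (HW : exists (W1 W2 : set 'rV[R]_n) (q : 'rV[R]_n),
      [/\ open W1 /\ periodic_set W1,
          open W2 /\ periodic_set W2,
          compactly_contained (torus_proj (translate q W2)) (@open_cube R n),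
          zero_set V1 `|` zero_set V2 `<=` W1 /\ W1 `<=` W2
        & (0 < set_dist W1 (boundary W2))%E /\
          (0 < set_dist (zero_set V1 `|` zero_set V2) (boundary W1))%E]) :
  exists gamma : R, 0 < gamma /\
    forall P : 'rV[R]_n, enorm P <= gamma -> Hbar P = 0.
Proof.
have [x0 [U1x0 U2x0]] := U12.
have [W1 [W2 [q [_ [oW2 pW2] qW2 [UW1 W12] _]]]] := HW.
have [a /andP[a0 a2] aW2] := nint_margin _ _ _ _ qW2.
have pC : periodic_set (~` W2).
  by move=> x k; split=> nW W; apply: nW; apply/(pW2 x k).
(* All zeros of [V] lie in [W2], so [V] is positive on the closed periodic complement, hence bounded
   away from 0 there. *)
have bound (V : 'rV[R]_n -> R) : continuous V -> periodic_fun V ->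
    (forall x, 0 <= V x) -> zero_set V `<=` W2 ->
    exists2 d, 0 < d & forall x, ~ W2 x -> d <= V x.
  move=> cV pV V0 VW; apply: (periodic_pos_bound _ _ V (~` W2)) => //; first exact: open_closedC.
  move=> x nW; rewrite lt_def V0 andbT; apply/eqP => Vx.
  exact/nW/VW.
have [d1 d10 V1d] : exists2 d, 0 < d & forall x, ~ W2 x -> d <= V1 x.
  by apply: bound => // x Ux; apply/W12/UW1; left.
have [d2 d20 V2d] : exists2 d, 0 < d & forall x, ~ W2 x -> d <= V2 x.
  by apply: bound => // x Ux; apply/W12/UW1; right.
pose d := Num.min d1 d2.
have d0 : 0 < d by rewrite lt_min d10.
(* The slope of the staircase is at most $1/a$, so $|P+Dw|^2\le|P|^2/a^2$, and this threshold makes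
   the right side at most [d]. *)
exists (a * Num.sqrt d); split; first by rewrite mulr_gt0// sqrtr_gt0.
move=> P HP; have [[v1 [v2 [[cv1 pv1] [cv2 pv2] [sub1 sup1] [sub2 sup2]]]] _] :=
  HbarP P.
apply/eqP; rewrite eq_le; apply/andP; split; last first.
  (* At the common zero the coupling differences are opposite and cancel in the sum. *)
  have := subsolution_le _ _ _ _ _ _ _ V1cont cv1 cv2 sub1 x0.
  have := subsolution_le _ _ _ _ _ _ _ V2cont cv2 cv1 sub2 x0.
  by rewrite U1x0 U2x0; lra.
apply: (supersolution_le _ _ V1 V2 v1 v2 (corrector R n a q P) P) => //.
  exact: periodic_corrector.
move=> x; have [phi [C1phi wphi gradE]] := corrector_local R n a q P a0 a2 x.
suff H : enorm (P + grad phi x) ^+ 2 <= V1 x /\ enorm (P + grad phi x) ^+ 2 <= V2 x.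
  by exists phi; case: H.
rewrite gradE sqr_enorm; set S := \sum_(i < n) _.
(* On [W2] every tent vanishes and $V_i\ge0$ suffices; off [W2] both potentials are at least [d]. *)
have [Wx|nWx] := pselect (W2 x).
  suff -> : S = 0 by [].
  by rewrite /S big1 // => i _; rewrite mxE tent_eq0 ?mulr0 ?expr0n//; exact: aW2.
suff Sd : S <= d.
  split; apply: (le_trans Sd).
    by apply: le_trans (V1d _ nWx); rewrite ge_min lexx.
  by apply: le_trans (V2d _ nWx); rewrite ge_min lexx orbT.
apply: (@le_trans _ _ ((a^-1) ^+ 2 * enorm P ^+ 2)).
  rewrite sqr_enorm mulr_sumr; apply: ler_sum => i _.
  rewrite mxE exprMn mulrC ler_wpM2r ?sqr_ge0// ler_sqr ?nnegrE ?invr_ge0 ?(ltW a0)//.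
    exact: tent_le.
  exact: tent_ge0.
rewrite exprVn ler_pdivrMl ?exprn_gt0// -[d in leRHS](sqr_sqrtr (ltW d0)) -exprMn.
by rewrite ler_sqr ?nnegrE ?sqrtr_ge0// mulr_ge0 ?sqrtr_ge0// ltW.
Qed.
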